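(* Let $n$ be a positive integer. For every idempotent $Q\in\mathbb{C}^{n\times n}$ with matched projection $m(Q)$, we have $$\frac{\sqrt{2}}{2}\cdot\|P_{\mathcal{R}(Q)}-Q\|_F\le \|m(Q)-Q\|_F\le \|P_{\mathcal{R}(Q)}-Q\|_F.$$ Moreover, each of the two inequalities is an equality if and only if $Q$ is a projection.
   Context: An idempotent is a matrix $Q$ with $Q^2=Q$; a projection is a Hermitian idempotent. $\mathcal{R}(Q)$ is the column range of $Q$ and $P_{\mathcal{R}(Q)}$ is the (orthogonal) projection from $\mathbb{C}^n$ onto $\mathcal{R}(Q)$. $\|\cdot\|_F$ is the Frobenius norm, $A^*$ the conjugate transpose, $A^\dag$ the Moore-Penrose inverse, and $|A|=(A^*A)^{1/2}$ the positive semi-definite square root, so $|Q^*|=(QQ^* )^{1/2}$. For an idempotent $Q\in\mathbb{C}^{n\times n}$ the matched projection is $$m(Q)=\tfrac12\big(|Q^*|+Q^*\big)\,|Q^*|^\dag\,\big(|Q^*|+I_n\big)^{-1}\big(|Q^*|+Q\big),$$ which is known to be a projection. *)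

(* Defs.v *)
From mathcomp Require Import all_boot all_order all_algebra.
From mathcomp Require Import complex.
From mathcomp Require Import boolp classical_sets reals.

Set Implicit Arguments.
Unset Strict Implicit.
Unset Printing Implicit Defensive.

Import Order.TTheory GRing.Theory Num.Theory.

Local Open Scope ring_scope.
Local Open Scope sesquilinear_scope.
Local Open Scope classical_set_scope.
Local Open Scope complex_scope.

Section MatrixNotions.
Context {C : numClosedFieldType}.

Definition is_idempotent n (Q : 'M[C]_n) : Prop := Q *m Q = Q.

Definition is_projection n (P : 'M[C]_n) : Prop :=
  P \is hermsymmx /\ is_idempotent P.

(* In C, [0 <= z] means that z is a nonnegative real number. *)
Definition is_psd n (A : 'M[C]_n) : Prop :=
  A \is hermsymmx /\ forall x : 'cV[C]_n, 0 <= (x^t* *m A *m x) 0 0.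

(* The [xget] default is never reached on psd matrices, and the value is then
   determined: [psd_sqrtP], [psd_sqrt_unique]. *)
Definition psd_sqrt n (A : 'M[C]_n) : 'M[C]_n :=
  xget 0 [set S : 'M[C]_n | is_psd S /\ S *m S = A].

Definition absmx m n (A : 'M[C]_(m, n)) : 'M[C]_n := psd_sqrt (A^t* *m A).

(* The four Penrose equations. *)
Definition is_mp_inverse m n (A : 'M[C]_(m, n)) (X : 'M[C]_(n, m)) : Prop :=
  [/\ A *m X *m A = A, X *m A *m X = X,
      A *m X \is hermsymmx & X *m A \is hermsymmx].

(* This is not [pinvmx], which need not satisfy all four equations; existence
   and uniqueness are [mp_inverseP] and [is_mp_inverse_unique]. *)
Definition mp_inverse m n (A : 'M[C]_(m, n)) : 'M[C]_(n, m) :=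
  xget 0 [set X : 'M[C]_(n, m) | is_mp_inverse A X].

Definition col_range m n (A : 'M[C]_(m, n)) : set 'cV[C]_m :=
  range (fun x : 'cV[C]_n => A *m x).

(* [proj_ortho] acts on row vectors and projects onto a row space, whence the
   two transpositions; see [range_projP]. *)
Definition range_proj m n (A : 'M[C]_(m, n)) : 'M[C]_m := (proj_ortho A^T)^T.

Definition matched_proj n (Q : 'M[C]_n) : 'M[C]_n :=
  let S := absmx (Q^t* ) in
  2^-1 *: ((S + Q^t*) *m mp_inverse S *m invmx (S + 1%:M) *m (S + Q)).

Lemma hermsymmxP n (A : 'M[C]_n) : reflect (A^t* = A) (A \is hermsymmx).
Proof.
by apply: (iffP (is_hermitianmxP _ _ _)); rewrite expr0 scale1r => /esym.
Qed.

Lemma adjmxM m n p (A : 'M[C]_(m, n)) (B : 'M[C]_(n, p)) :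
  (A *m B)^t* = B^t* *m A^t*.
Proof. by rewrite trmx_mul map_mxM. Qed.

Lemma mxtrace_gram m n (A : 'M[C]_(m, n)) :
  \tr (A *m A^t* ) = \sum_i \sum_j `|A i j| ^+ 2.
Proof.
rewrite /mxtrace; apply: eq_bigr => i _; rewrite mxE.
by apply: eq_bigr => j _; rewrite !mxE normCK.
Qed.

Lemma mxtrace_gram_ge0 m n (A : 'M[C]_(m, n)) : 0 <= \tr (A *m A^t* ).
Proof.
rewrite mxtrace_gram; apply: sumr_ge0 => i _.
by apply: sumr_ge0 => j _; apply: exprn_ge0.
Qed.

Lemma mxtrace_gram_eq0 m n (A : 'M[C]_(m, n)) : \tr (A *m A^t* ) = 0 -> A = 0.
Proof.
rewrite mxtrace_gram pair_big /= => /psumr_eq0P A0; apply/matrixP => i j.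
have /eqP := A0 (fun _ _ => exprn_ge0 _ (normr_ge0 _)) (i, j) isT.
by rewrite sqrf_eq0 normr_eq0 mxE => /eqP.
Qed.

Lemma gram_unit m n (A : 'M[C]_(m, n)) : row_free A -> A *m A^t* \in unitmx.
Proof.
move=> Afree; rewrite -row_free_unit.
have kA0 : kermx (A *m A^t*) = 0.
  set K := kermx _; have KA : K *m A *m (K *m A)^t* = 0.
    by rewrite adjmxM !mulmxA -[K *m A *m _]mulmxA mulmx_ker mul0mx.
  have /mxtrace_gram_eq0/eqP : \tr (K *m A *m (K *m A)^t* ) = 0.
    by rewrite KA mxtrace0.
  by rewrite mulmx_free_eq0 // => /eqP.
by rewrite -kermx_eq0 kA0.
Qed.

Lemma is_mp_inverse_unique m n (A : 'M[C]_(m, n)) (X Y : 'M[C]_(n, m)) :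
  is_mp_inverse A X -> is_mp_inverse A Y -> X = Y.
Proof.
move=> [AXA XAX /hermsymmxP hAX /hermsymmxP hXA].
move=> [AYA YAY /hermsymmxP hAY /hermsymmxP hYA].
have eqA : A *m X = A *m Y.
  rewrite -hAX -{1}AYA adjmxM [(A *m Y *m A)^t*]adjmxM hAY mulmxA -adjmxM hAX.
  by rewrite mulmxA AXA.
have eqB : X *m A = Y *m A.
  rewrite -hXA -{1}AYA -mulmxA [X *m _]mulmxA adjmxM hXA hYA -mulmxA.
  by rewrite [A *m (X *m A)]mulmxA AXA.
by rewrite -XAX eqB -mulmxA eqA mulmxA.
Qed.

Lemma mp_inverseP m n (A : 'M[C]_(m, n)) : is_mp_inverse A (mp_inverse A).
Proof.
apply: (@xgetPex _ 0 [set X : 'M[C]_(n, m) | is_mp_inverse A X]).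
have [r [B [D [AE uB uD]]]] : exists r (B : 'M[C]_(m, r)) (D : 'M[C]_(r, n)),
    [/\ A = B *m D, B^t* *m B \in unitmx & D *m D^t* \in unitmx].
  exists (\rank A), (col_base A), (row_base A); split.
  - by rewrite mulmx_base.
  - have := @gram_unit _ _ ((col_base A)^t* ); rewrite trmxCK; apply.
    by rewrite /row_free mxrank_map mxrank_tr; exact: col_base_full.
  - exact/gram_unit/row_base_free.
have hD : (invmx (D *m D^t*))^t* = invmx (D *m D^t*).
  by rewrite trmx_inv map_invmx adjmxM trmxCK.
have hB : (invmx (B^t* *m B))^t* = invmx (B^t* *m B).
  by rewrite trmx_inv map_invmx adjmxM trmxCK.
pose X := D^t* *m invmx (D *m D^t*) *m invmx (B^t* *m B) *m B^t*.
have AX : A *m X = B *m invmx (B^t* *m B) *m B^t*.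
  by rewrite AE /X -!mulmxA [D *m (D^t* *m _)]mulmxA (mulKVmx uD) !mulmxA.
have XA : X *m A = D^t* *m invmx (D *m D^t*) *m D.
  by rewrite AE /X -!mulmxA [B^t* *m (B *m _)]mulmxA (mulKmx uB).
exists X; split.
- by rewrite AX AE -!mulmxA [B^t* *m (B *m _)]mulmxA (mulKmx uB).
- by rewrite XA /X -!mulmxA [D *m (D^t* *m _)]mulmxA (mulKmx uD).
- by apply/hermsymmxP; rewrite AX !adjmxM trmxCK hB mulmxA.
- by apply/hermsymmxP; rewrite XA !adjmxM trmxCK hD mulmxA.
Qed.

Lemma range_projP m n (A : 'M[C]_(m, n)) :
  is_projection (range_proj A) /\ col_range (range_proj A) = col_range A.
Proof.
rewrite /range_proj; set P := proj_ortho A^T.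
have PP : P *m P = P by exact: proj_ortho_proj.
have PC0 : (1%:M - P) *m P^t* = 0.
  have ort : ((1%:M : 'M_m) - 1%:M *m P <= orthomx Num.conj
      (mx_of_hermitian (hermitian1mx _)) A^T)%MS by exact: proj_ortho_compl_sub.
  have PA : (P <= A^T)%MS by rewrite -[P]mul1mx proj_ortho_sub.
  move: ort; rewrite mul1mx orthomx1E => /eqP ort.
  case/submxP: PA => D PD.
  have -> : P^t* = A^T^t* *m D^t* by rewrite -adjmxM -PD.
  by rewrite mulmxA ort mul0mx.
have eqPA : (P :=: A^T)%MS by exact: proj_orthoE.
clearbody P.
have PPh : P^t* = P *m P^t*.
  by apply/eqP; rewrite -subr_eq0 -{1}[P^t*]mul1mx -mulmxBl PC0.
have hP : P^t* = P.
  have := congr1 (fun M : 'M[C]_m => M^t* ) PPh.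
  by rewrite /= adjmxM !trmxCK -PPh.
split; first split.
- by apply/hermsymmxP; rewrite -map_trmx hP.
- by rewrite /is_idempotent -trmx_mul PP.
have eq_range k l (B : 'M[C]_(m, k)) (D : 'M[C]_(m, l)) :
    (B^T <= D^T)%MS -> col_range B `<=` col_range D.
  case/submxP => M BM _ [x _ <-]; exists (M^T *m x) => //.
  by rewrite mulmxA -[B]trmxK BM trmx_mul trmxK.
by apply/seteqP; split; apply: eq_range; rewrite ?trmxK eqPA.
Qed.

Lemma psd_gram m n (A : 'M[C]_(m, n)) : is_psd (A^t* *m A).
Proof.
split=> [|x]; first by apply/hermsymmxP; rewrite adjmxM trmxCK.
rewrite mulmxA -adjmxM -mulmxA mxE; apply: sumr_ge0 => k _.
by rewrite !mxE mulrC mul_conjC_ge0.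
Qed.

Lemma psd_sqrtP n (A : 'M[C]_n) :
  is_psd A -> is_psd (psd_sqrt A) /\ psd_sqrt A *m psd_sqrt A = A.
Proof.
move=> [hA psdA].
apply: (@xgetPex _ 0 [set S : 'M[C]_n | is_psd S /\ S *m S = A]).
have /orthomx_spectralP := hermitian_normalmx hA.
set U := spectralmx A; set d := spectral_diag A.
have uU : U \is unitarymx := spectral_unitarymx A.
rewrite (invmx_unitary uU) => AE.
have UU : U *m U^t* = 1%:M by exact/unitarymxP.
have UAU : U *m A *m U^t* = diag_mx d.
  by rewrite {1}AE -!mulmxA UU mulmx1 !mulmxA UU mul1mx.
have d_ge0 i : 0 <= d 0 i.
  have := psdA (U^t* *m delta_mx i 0).
  rewrite adjmxM trmxCK -!mulmxA [A *m _]mulmxA [U *m (_ *m _)]mulmxA.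
  rewrite [U *m (A *m _)]mulmxA UAU trmx_delta map_delta_mx mulmxA -rowE -colE.
  by rewrite !mxE eqxx mulr1n.
pose e : 'rV[C]_n := map_mx sqrtC d.
pose f : 'rV[C]_n := map_mx sqrtC e.
have ee : diag_mx e *m diag_mx e = diag_mx d.
  rewrite mulmx_diag; congr diag_mx; apply/rowP=> i.
  by rewrite !mxE -expr2 sqrtCK.
have ff : diag_mx f *m diag_mx f = diag_mx e.
  rewrite mulmx_diag; congr diag_mx; apply/rowP=> i.
  by rewrite !mxE -expr2 sqrtCK.
have hf : (diag_mx f)^t* = diag_mx f.
  rewrite tr_diag_mx map_diag_mx; congr diag_mx; apply/rowP=> i.
  by rewrite !mxE; apply: geC0_conj; rewrite !sqrtC_ge0.
exists (U^t* *m diag_mx e *m U); split.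
  have -> : U^t* *m diag_mx e *m U = (diag_mx f *m U)^t* *m (diag_mx f *m U).
    by rewrite adjmxM hf -ff !mulmxA.
  exact: psd_gram.
by rewrite [RHS]AE -ee !mulmxA -[_ *m U *m U^t*]mulmxA UU mulmx1.
Qed.

Lemma psd_mxtrace n (S D : 'M[C]_n) : is_psd S ->
  0 <= \tr (D^t* *m S *m D) /\ (\tr (D^t* *m S *m D) = 0 -> S *m D = 0).
Proof.
move=> psdS; have [[/hermsymmxP hR _] RR] := psd_sqrtP psdS.
set R := psd_sqrt S in hR RR *.
have -> : D^t* *m S *m D = (R *m D)^t* *m ((R *m D)^t* )^t*.
  by rewrite trmxCK adjmxM hR -RR !mulmxA.
split=> [|/mxtrace_gram_eq0 RD0]; first exact: mxtrace_gram_ge0.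
by rewrite -RR -mulmxA -[R *m D]trmxCK RD0 trmx0 map_mx0 mulmx0.
Qed.

Lemma psd_sqrt_unique n (S T : 'M[C]_n) :
  is_psd S -> is_psd T -> S *m S = T *m T -> S = T.
Proof.
move=> psdS psdT eqST; pose D := S - T.
have hD : D^t* = D.
  have [[/hermsymmxP hS _] [/hermsymmxP hT _]] := (psdS, psdT).
  by rewrite linearB /= map_mxB hS hT.
have anti : (S + T) *m D = - (D *m (S + T)).
  rewrite /D mulmxBr mulmxBl !mulmxDl !mulmxDr eqST opprB.
  by rewrite addrC [in RHS]addrC [T *m T + T *m S]addrC [T *m T + S *m T]addrC.
have tr0 : \tr (D^t* *m S *m D) + \tr (D^t* *m T *m D) = 0.
  have : \tr (D *m (S + T) *m D) = - \tr (D *m (S + T) *m D).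
    by rewrite -{1}mulmxA anti mulmxN linearN /= mxtrace_mulC.
  rewrite hD -linearD -mulmxDl -mulmxDr /= => /eqP.
  by rewrite -addr_eq0 -mulr2n mulrn_eq0 => /eqP.
have [S_ge0 S0] := psd_mxtrace D psdS; have [T_ge0 T0] := psd_mxtrace D psdT.
have /andP[/eqP trS /eqP trT] : (\tr (D^t* *m S *m D) == 0) &&
    (\tr (D^t* *m T *m D) == 0) by rewrite -paddr_eq0 // tr0.
have DD : D *m D^t* = 0 by rewrite hD {1}/D mulmxBl S0 // T0 // subrr.
have : D = 0 by apply: mxtrace_gram_eq0; rewrite DD mxtrace0.
by move/eqP; rewrite subr_eq0 => /eqP.
Qed.

End MatrixNotions.

Definition frobenius (R : realType) m n (A : 'M[R[i]]_(m, n)) : R :=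
  Num.sqrt (\sum_(i < m) \sum_(j < n) Normc.normc (A i j) ^+ 2).

(* Main.v *)
(* Write [P] for the projection onto the range of [Q] and [S] for [|Q^*|].
   From [P Q = Q] and [Q P = P] one gets [Q S = S], [(S + Q)(S + Q^* ) = 2 S (S + 1)]
   and [S S^+ = P], so that [m(Q)] is a projection and
     |m(Q) - Q|^2 = tr S^2 - tr S,    |P - Q|^2 = tr S^2 - tr P.
   The two inequalities are then the nonnegativity of [tr (S - P)] and of
     2 |m(Q) - Q|^2 - |P - Q|^2 = tr (S^2 - 2 S + P) = |S - P|^2.
   The former holds because [S - P = (S^2 - P)(S + 1)^-1] and
   [S^2 - P = (P - Q)(P - Q)^*]; either trace vanishes only if [P = Q]. *)
Require Import Defs.
From mathcomp Require Import all_boot all_order all_algebra.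
From mathcomp Require Import complex reals.
From mathcomp Require Import classical_sets.
From mathcomp Require Import ring lra.

Import Order.TTheory GRing.Theory Num.Theory.

Local Open Scope ring_scope.
Local Open Scope sesquilinear_scope.

Section ComplexMatrices.
Set Implicit Arguments.
Unset Strict Implicit.
Unset Printing Implicit Defensive.
Context {C : numClosedFieldType}.

(** * Adjoints, and idempotents acting on ranges *)

Lemma adjmxB m n (A B : 'M[C]_(m, n)) : (A - B)^t* = A^t* - B^t*.
Proof. by rewrite linearB /= map_mxB. Qed.

Lemma adjmxD m n (A B : 'M[C]_(m, n)) : (A + B)^t* = A^t* + B^t*.
Proof. by rewrite linearD /= map_mxD. Qed.

Lemma adjmx1 n : (1%:M : 'M[C]_n)^t* = 1%:M.
Proof. by rewrite trmx1 map_mx1. Qed.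

Lemma adjmx_inv n (A : 'M[C]_n) : (invmx A)^t* = invmx (A^t* ).
Proof. by rewrite trmx_inv map_invmx. Qed.

Lemma gram_eq0 m n (A : 'M[C]_(m, n)) : A *m A^t* = 0 -> A = 0.
Proof. by move=> A0; apply: mxtrace_gram_eq0; rewrite A0 mxtrace0. Qed.

(** An idempotent fixes every vector of its range, in particular each column [A *m delta_mx j 0]. *)
Lemma mul_idempotent_range m n (P : 'M[C]_m) (A : 'M[C]_(m, n)) :
  is_idempotent P -> (col_range A `<=` col_range P)%classic -> P *m A = A.
Proof.
move=> PP sAP; apply/matrixP=> i j.
have [|y _ eAj] := sAP (A *m delta_mx j (0 : 'I_1)); first by exists (delta_mx j 0).
have : P *m (A *m delta_mx j (0 : 'I_1)) = A *m delta_mx j (0 : 'I_1).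
  by rewrite -eAj mulmxA PP.
by rewrite mulmxA -!colE => /matrixP/(_ i 0); rewrite !mxE.
Qed.

Lemma mul_range_proj m n (A : 'M[C]_(m, n)) : range_proj A *m A = A.
Proof.
have [[_ PP] eqR] := range_projP A.
by apply: mul_idempotent_range => //; rewrite eqR.
Qed.

Lemma idempotent_mul_range_proj n (Q : 'M[C]_n) :
  is_idempotent Q -> Q *m range_proj Q = range_proj Q.
Proof.
move=> QQ; have [_ eqR] := range_projP Q.
by apply: mul_idempotent_range => //; rewrite eqR.
Qed.

Lemma adjmx_range_proj m n (A : 'M[C]_(m, n)) : (range_proj A)^t* = range_proj A.
Proof. by have [[/hermsymmxP]] := range_projP A. Qed.

(** With [P] the range projection, [P = Q P = (P Q)^* = Q^* = Q]. *)
Lemma range_proj_projection n (Q : 'M[C]_n) : is_projection Q -> range_proj Q = Q.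
Proof.
move=> [/hermsymmxP hQ QQ]; rewrite -[LHS](idempotent_mul_range_proj QQ).
by rewrite -{1}hQ -adjmx_range_proj -adjmxM mul_range_proj.
Qed.

(** * Inverses attached to a positive semi-definite or Hermitian matrix *)

(** If [K (S + 1) = 0], the nonnegative traces of [K S K^*] and [K K^*] add up to zero, so
    [K = 0]. *)
Lemma psd_add1_unit n (S : 'M[C]_n) : is_psd S -> S + 1%:M \in unitmx.
Proof.
move=> psdS; rewrite -row_free_unit -kermx_eq0; apply/eqP.
set K := kermx _.
have trKSK : \tr (K *m S *m K^t* ) + \tr (K *m K^t* ) = 0.
  by rewrite -linearD -mulmxDl -{2}[K]mulmx1 -mulmxDr /= mulmx_ker mul0mx mxtrace0.
have [KSK_ge0 _] := psd_mxtrace (K^t* ) psdS; rewrite trmxCK in KSK_ge0.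
apply: mxtrace_gram_eq0; apply/eqP.
move/eqP: trKSK; rewrite paddr_eq0 ?mxtrace_gram_ge0 //.
by case/andP.
Qed.

(** The inverse [K] is Hermitian, so [K = K (S + 1) K = K^* S K + K^* K], a sum of two positive
    semi-definite matrices. *)
Lemma psd_inv_add1 n (S : 'M[C]_n) : is_psd S -> is_psd (invmx (S + 1%:M)).
Proof.
move=> psdS; have u := psd_add1_unit psdS; have [/hermsymmxP hS posS] := psdS.
set K := invmx _; have hK : K^t* = K by rewrite adjmx_inv adjmxD hS adjmx1.
have KE : K = K^t* *m S *m K + K^t* *m K.
  by rewrite hK -mulmxDl -{3}[K]mulmx1 -mulmxDr (mulVmx u) mul1mx.
split; first exact/hermsymmxP.
move=> x; rewrite KE mulmxDr mulmxDl mxE addr_ge0 //.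
  have -> : x^t* *m (K^t* *m S *m K) *m x = (K *m x)^t* *m S *m (K *m x).
    by rewrite adjmxM !mulmxA.
  exact: posS.
by have [_] := psd_gram K; apply.
Qed.

(** Adjoints of the Penrose equations show that [X^*] solves them for [S^* = S]; uniqueness
    concludes. *)
Lemma mp_inverse_hermitian n (S : 'M[C]_n) :
  S^t* = S -> (mp_inverse S)^t* = mp_inverse S.
Proof.
move=> hS; have := mp_inverseP S; set X := mp_inverse S => -[SXS XSX hSX hXS].
apply: (@is_mp_inverse_unique _ _ _ S); last exact: mp_inverseP.
have SX : S *m X^t* = X *m S by rewrite -{1}hS -adjmxM; exact/hermsymmxP.
have XS : X^t* *m S = S *m X by rewrite -{1}hS -adjmxM; exact/hermsymmxP.
split; last by rewrite XS.
- by rewrite -[RHS]hS -[in RHS]SXS !adjmxM hS mulmxA.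
- by rewrite -[in RHS]XSX !adjmxM hS mulmxA.
- by rewrite SX.
Qed.

(** * Identities for [P], [S] and the matched projection [M] *)

Section MatchedProjection.
Context {n : nat} (Q : 'M[C]_n) (QQ : is_idempotent Q).

Let P := range_proj Q.
Let S := absmx (Q^t* ).
Let X := mp_inverse S.
Let K := invmx (S + 1%:M).

Let PQ : P *m Q = Q := mul_range_proj Q.
Let QP : Q *m P = P := idempotent_mul_range_proj QQ.
Let hP : P^t* = P := adjmx_range_proj Q.

Let PQh : P *m Q^t* = P.
Proof. by rewrite -hP -adjmxM QP. Qed.

Let QhP : Q^t* *m P = Q^t*.
Proof. by rewrite -hP -adjmxM PQ. Qed.

Let PP : P *m P = P.
Proof. by rewrite -{2}QP mulmxA PQ QP. Qed.

Let psdSS : is_psd S /\ S *m S = Q *m Q^t*.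
Proof. by rewrite -{1}[Q]trmxCK; exact/psd_sqrtP/psd_gram. Qed.

Let psdS : is_psd S := psdSS.1.
Let SS : S *m S = Q *m Q^t* := psdSS.2.

Let hS : S^t* = S.
Proof. by have [/hermsymmxP] := psdS. Qed.

(** As [S S = Q Q^*], the Gram matrix of [P S - S] equals that of [P Q - Q = 0]. *)
Let PS : P *m S = S.
Proof.
apply/eqP; rewrite -subr_eq0 -{2}[S]mul1mx -mulmxBl; apply/eqP/gram_eq0.
by rewrite adjmxM hS mulmxA -[_ *m S *m S]mulmxA SS mulmxA mulmxBl PQ mul1mx
  subrr !mul0mx.
Qed.

Let SP : S *m P = S.
Proof. by rewrite -hP -hS -adjmxM PS. Qed.

Let QS : Q *m S = S.
Proof. by rewrite -PS mulmxA QP. Qed.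

Let SQh : S *m Q^t* = S.
Proof. by rewrite -{1}hS -adjmxM QS hS. Qed.

(** The same Gram argument gives [S X Q = Q], hence [S X P = P] because [P = Q P]. Its adjoint is
    [P S X = P], whereas [P S = S] makes the left side [S X]. *)
Let SX : S *m X = P.
Proof.
have [SXS _ /hermsymmxP hSX _] := mp_inverseP S; rewrite -/X in SXS hSX.
have SXQ : S *m X *m Q = Q.
  apply/eqP; rewrite -subr_eq0 -{2}[Q]mul1mx -mulmxBl; apply/eqP/gram_eq0.
  by rewrite adjmxM mulmxA -[_ *m Q *m Q^t*]mulmxA -SS mulmxA mulmxBl SXS mul1mx
    subrr !mul0mx.
have PSX : P *m (S *m X) = P by rewrite -hSX -hP -adjmxM -QP mulmxA SXQ.
by rewrite -PSX mulmxA PS.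
Qed.

Let hX : X^t* = X := mp_inverse_hermitian hS.

Let XS : X *m S = P.
Proof. by rewrite -hX -hS -adjmxM SX. Qed.

Let XP : X *m P = X.
Proof. by have [_ XSX _ _] := mp_inverseP S; rewrite -SX mulmxA. Qed.

Let PX : P *m X = X.
Proof. by rewrite -hX -hP -adjmxM XP. Qed.

Let uS : S + 1%:M \in unitmx := psd_add1_unit psdS.

Let hK : K^t* = K.
Proof. by rewrite adjmx_inv adjmxD hS adjmx1. Qed.

Let KS1 : K *m (S + 1%:M) = 1%:M.
Proof. exact: mulVmx. Qed.

Let S1K : (S + 1%:M) *m K = 1%:M.
Proof. exact: mulmxV. Qed.

Let commute_inv_add1 A : A *m S = S *m A -> A *m K = K *m A.
Proof.
move=> AS; rewrite -[A *m K]mul1mx -{1}KS1 mulmxA -[K *m _ *m A]mulmxA.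
by rewrite mulmxDl mul1mx -AS -{2}[A]mulmx1 -mulmxDr -!mulmxA S1K mulmx1.
Qed.

Let XK : X *m K = K *m X.
Proof. by apply: commute_inv_add1; rewrite XS SX. Qed.

Let SS1 : S *m (S + 1%:M) = S *m S + S.
Proof. by rewrite mulmxDr mulmx1. Qed.

(** [X] inverts [S] up to [P], and [K] inverts [S + 1]; so [X K] inverts [S (S + 1)] up to [P]. *)
Let XKSS : X *m K *m (S *m S + S) = P.
Proof.
have -> : S *m S + S = (S + 1%:M) *m S by rewrite mulmxDl mul1mx.
by rewrite -mulmxA [K *m _]mulmxA KS1 mul1mx XS.
Qed.

Let SSXK : (S *m S + S) *m (X *m K) = P.
Proof. by rewrite XK mulmxA -SS1 -[_ *m K]mulmxA S1K mulmx1 SX. Qed.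

Let M := matched_proj Q.

Let ME : M = 2^-1 *: ((S + Q^t* ) *m (X *m K) *m (S + Q)).
Proof. by rewrite /M /matched_proj -/S -/X -/K !mulmxA. Qed.

(** This product is the centre of [M M]; its factor 2 cancels one of the two factors [1/2]. *)
Let QS_gram : (S + Q) *m (S + Q^t* ) = 2 *: (S *m S + S).
Proof.
rewrite mulmxDl !mulmxDr SQh QS -SS scaler_nat mulr2n.
by rewrite [S + S *m S]addrC.
Qed.

Lemma adjmx_matched_proj : M^t* = M.
Proof.
rewrite ME linearZ /= map_mxZ /= !adjmxM !adjmxD !trmxCK hS hK hX XK.
by rewrite fmorphV rmorph_nat mulmxA.
Qed.

(** With [Y = X K], it comes down to [Y (S^2 + S) Y = P Y = Y]. *)
Lemma matched_proj_idempotent : M *m M = M.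
Proof.
rewrite ME -scalemxAl -scalemxAr; congr (_ *: _).
set A := S + Q^t*; set B := S + Q; set Y := X *m K.
have -> : A *m Y *m B *m (A *m Y *m B) = A *m (Y *m (B *m A) *m Y) *m B.
  by rewrite !mulmxA.
rewrite QS_gram -scalemxAr -scalemxAl -scalemxAr -scalemxAl scalerA.
rewrite mulVf ?pnatr_eq0 // scale1r; congr (_ *m _ *m _).
by rewrite XKSS /Y mulmxA PX.
Qed.

(** * Traces and squared distances *)

Lemma mxtrace_matched_proj : \tr M = \tr P.
Proof.
rewrite ME linearZ /=; set Y := X *m K.
rewrite mxtrace_mulC mulmxA QS_gram -scalemxAl linearZ /=.
by rewrite SSXK mulrA mulVf ?mul1r // pnatr_eq0.
Qed.

Let trQ : \tr Q = \tr P.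
Proof. by rewrite -PQ mxtrace_mulC QP. Qed.

Let trQh : \tr (Q^t* ) = \tr P.
Proof. by rewrite -QhP mxtrace_mulC PQh. Qed.

(** On the left, [Q S + Q Q^* = S + S^2], which [X K] turns into [P]. There remains half the trace
    of [P (S + Q) = S + Q], and [Q] and [P] have equal traces. *)
Lemma mxtrace_mul_matched_proj : \tr (Q *m M) = 2^-1 * (\tr S + \tr P).
Proof.
rewrite ME -scalemxAr linearZ /=; move: (X *m K) SSXK => Y SSY.
rewrite !mulmxA [Q *m _]mulmxDr QS -SS [S + S *m S]addrC SSY.
by rewrite mulmxDr PS PQ linearD /= trQ.
Qed.

Lemma mxtrace_matched_proj_mul : \tr (M *m Q^t* ) = 2^-1 * (\tr S + \tr P).
Proof.
rewrite ME -scalemxAl linearZ /=; move: (X *m K) XKSS => Y YSS.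
rewrite -!mulmxA [_ *m Q^t*]mulmxDl SQh -SS [S + S *m S]addrC YSS.
by rewrite mulmxDl SP QhP linearD /= trQh.
Qed.

(** The two cross terms together subtract [\tr S + \tr P], and [\tr P] cancels against
    [\tr (M M)]. *)
Lemma mxtrace_gram_matched_proj :
  \tr ((M - Q) *m (M - Q)^t* ) = \tr (Q *m Q^t* ) - \tr S.
Proof.
rewrite adjmxB adjmx_matched_proj mulmxBl !mulmxBr matched_proj_idempotent.
rewrite !linearB /= mxtrace_matched_proj mxtrace_mul_matched_proj.
rewrite mxtrace_matched_proj_mul.
by field.
Qed.

Lemma gram_range_proj : (P - Q) *m (P - Q)^t* = Q *m Q^t* - P.
Proof.
rewrite adjmxB hP mulmxBl !mulmxBr PP PQh QP subrr sub0r.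
by rewrite opprB.
Qed.

Let SPE : S - P = K *m ((P - Q) *m (P - Q)^t* ).
Proof.
rewrite gram_range_proj -SS.
have -> : S *m S - P = (S + 1%:M) *m (S - P).
  by rewrite mulmxDl mul1mx mulmxBr SP subrKA.
by rewrite mulmxA KS1 mul1mx.
Qed.

(** By cyclicity the difference is [\tr (D^* K D)] with [D = P - Q] and [K] positive semi-definite.
    If it vanishes then [K D = 0], and [K] is invertible. *)
Lemma mxtrace_abs_range_proj :
  0 <= \tr S - \tr P /\ (\tr S = \tr P -> P = Q).
Proof.
have [ge0 eq0] := psd_mxtrace (P - Q) (psd_inv_add1 psdS).
have trE : \tr S - \tr P = \tr ((P - Q)^t* *m K *m (P - Q)).
  by rewrite -linearB /= SPE mulmxA mxtrace_mulC mulmxA.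
split=> [|trSP]; first by rewrite trE.
apply/eqP; rewrite -subr_eq0 -[_ - _]mul1mx -S1K -mulmxA.
by rewrite eq0 ?mulmx0 // -trE trSP subrr.
Qed.

Lemma mxtrace_gram_abs_range_proj :
  \tr ((S - P) *m (S - P)^t* ) = \tr (Q *m Q^t* ) - 2 * \tr S + \tr P.
Proof.
rewrite adjmxB hS hP mulmxBl !mulmxBr SS SP PS PP !linearB /=.
ring.
Qed.

Lemma abs_eq_range_proj : S = P -> P = Q.
Proof.
move=> eqSP; apply/eqP; rewrite -subr_eq0; apply/eqP/gram_eq0.
by rewrite gram_range_proj -SS eqSP PP subrr.
Qed.

(** The theorem in squared form, over [C]: every claim is read off from [2 b - a] or [a - b]. *)
Lemma matched_proj_gram_bounds :
  let a := \tr ((P - Q) *m (P - Q)^t* ) in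
  let b := \tr ((M - Q) *m (M - Q)^t* ) in
  [/\ a <= 2 * b, b <= a, a = 2 * b -> P = Q & b = a -> P = Q].
Proof.
rewrite /= mxtrace_gram_matched_proj gram_range_proj linearB /=.
set q := \tr (Q *m _); have [trSP eqSP] := mxtrace_abs_range_proj.
have gramE := mxtrace_gram_abs_range_proj.
have diffE : 2 * (q - \tr S) - (q - \tr P) = \tr ((S - P) *m (S - P)^t* ).
  by rewrite gramE -/q; ring.
split.
- by rewrite -subr_ge0 diffE mxtrace_gram_ge0.
- by rewrite lerB // -subr_ge0.
- move=> /esym/eqP; rewrite -subr_eq0 diffE => /eqP/mxtrace_gram_eq0/eqP.
  by rewrite subr_eq0 => /eqP/abs_eq_range_proj.
- by move=> /addrI/oppr_inj/eqSP.
Qed.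

End MatchedProjection.
End ComplexMatrices.

(** * From complex traces to real Frobenius norms *)

Lemma sqr_frobenius (R : realType) (m n : nat) (A : 'M[R[i]]_(m, n)) :
  ((frobenius A ^+ 2)%:C)%C = \tr (A *m A^t* ).
Proof.
rewrite mxtrace_gram sqr_sqrtr; last first.
  by apply: sumr_ge0 => i _; apply: sumr_ge0 => j _; rewrite sqr_ge0.
rewrite rmorph_sum; apply: eq_bigr => i _; rewrite rmorph_sum.
by apply: eq_bigr => j _; rewrite rmorphXn.
Qed.

Theorem theorem5p4 (R : realType) (n : nat) (Q : 'M[R[i]]_n)
    (hn : (0 < n)%N) (hQ : is_idempotent Q) :
  [/\ Num.sqrt 2 / 2 * frobenius (range_proj Q - Q)
        <= frobenius (matched_proj Q - Q),
      frobenius (matched_proj Q - Q) <= frobenius (range_proj Q - Q),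
      Num.sqrt 2 / 2 * frobenius (range_proj Q - Q)
        = frobenius (matched_proj Q - Q) <-> is_projection Q
    & frobenius (matched_proj Q - Q) = frobenius (range_proj Q - Q)
        <-> is_projection Q].
Proof.
have [] := matched_proj_gram_bounds hQ; rewrite -!sqr_frobenius.
set a := frobenius (range_proj Q - Q); set b := frobenius (matched_proj Q - Q).
(* Seen as the image of a real number, 2 lets the inequalities descend from [R[i]] to [R]. *)
have two : 2 = ((2 : R)%:C)%C :> R[i] by rewrite rmorph_nat.
rewrite two -rmorphM /= !lecR => le_ab le_ba eq_ab eq_ba.
have a_ge0 : 0 <= a by exact: sqrtr_ge0.
have b_ge0 : 0 <= b by exact: sqrtr_ge0.
have s2 : (Num.sqrt 2 / 2) ^+ 2 = 2^-1 :> R.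
  by rewrite expr_div_n sqr_sqrtr //; field.
have s_ge0 : 0 <= Num.sqrt 2 / 2 :> R by rewrite divr_ge0 ?sqrtr_ge0.
(* Both equality cases of the trace bounds end in [P = Q], which is thus the criterion sought. *)
have proj_eq : range_proj Q = Q <-> is_projection Q.
  by split=> [<-|/range_proj_projection//]; have [] := range_projP Q.
have leb : b <= a by rewrite -ler_sqr.
(* For the converses: [P = Q] gives [a = 0], and then [0 <= b <= a] forces [b = 0]. *)
have proj0 : is_projection Q -> a = 0 /\ b = 0.
  move=> /proj_eq PQ; have a0 : a = 0.
    have /eqP : ((a ^+ 2)%:C)%C = 0 :> R[i].
      by rewrite sqr_frobenius PQ subrr mul0mx mxtrace0.
    by rewrite -(rmorph0 (real_complex R)) (inj_eq (fmorph_inj _)) sqrf_eq0 => /eqP.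
  by split=> //; apply/eqP; rewrite eq_le b_ge0 -a0 leb.
split=> //.
- have sa_ge0 : 0 <= Num.sqrt 2 / 2 * a by exact: mulr_ge0.
  by rewrite -ler_sqr // exprMn s2; lra.
- split=> [eqab|/proj0[-> ->]]; last by rewrite mulr0.
  apply/proj_eq/eq_ab; congr (_%:C)%C.
  by rewrite -eqab exprMn s2; field.
- by split=> [eqab|/proj0[-> ->//]]; apply/proj_eq/eq_ba; rewrite eqab.
Qed.
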